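(* Let $\mathcal{T}=(T,\eta,\mu)$ be the monad on $\mathcal{S}_s$ associated to the adjunction $(\eta,\varepsilon)$ between $(+):\mathcal{S}_s\to\mathcal{S}_f$ (left adjoint) and $(-):\mathcal{S}_f\to\mathcal{S}_s$ (right adjoint), i.e. $T=(-)\circ(+)$ and $\mu=(-)\varepsilon(+)$. Then the Kleisli category of $\mathcal{T}$ is $\mathcal{S}_f$ (a flexible morphism $f:\Sigma\to\Sigma'$ being the Kleisli morphism $f^\sharp:\Sigma\to T(\Sigma')$). Moreover, the functors $(+)$ and $(-)$ are precisely the canonical functors of the adjunction associated to the Kleisli category of a monad. More explicitly: given $\Sigma\xrightarrow{f}\Sigma'\xrightarrow{f'}\Sigma''$ in $\mathcal{S}_f$, one has $f'\bullet f=(\mu_{\Sigma''}\circ T(f'^\sharp)\circ f^\sharp)^\flat$, i.e. in $\mathcal{S}_s$ $$\bigl(\Sigma\xrightarrow{f^\sharp}T(\Sigma')\xrightarrow{(\check{f'}\restriction_n)_{n\in\mathbb{N}}}T(\Sigma'')\bigr)=\bigl(\Sigma\xrightarrow{f^\sharp}T(\Sigma')\xrightarrow{T(f'^\sharp)}T(T(\Sigma''))\xrightarrow{\mu_{\Sigma''}}T(\Sigma'')\bigr).$$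
   Context: Fix an enumerable set of variables $X=\{x_0,x_1,\dots\}$. A signature is a sequence of pairwise disjoint sets $\Sigma=(\Sigma_n)_{n\in\mathbb{N}}$. $F(\Sigma)$ is the set of all formulas over $\Sigma$ with variables in $X$; $F(\Sigma)[n]=\{\varphi\in F(\Sigma):\mathrm{var}(\varphi)=\{x_0,\dots,x_{n-1}\}\}$, where $\mathrm{var}(\varphi)$ is the set of variables occurring in $\varphi$. $T(\Sigma):=(F(\Sigma)[n])_{n\in\mathbb{N}}$ is again a signature. $(j_\Sigma)_n:\Sigma_n\to F(\Sigma)[n]$, $c_n\mapsto c_n(x_0,\dots,x_{n-1})$. $\mathcal{S}_s$: objects are signatures; a (strict) morphism $f:\Sigma\to\Sigma'$ is a sequence of functions $f_n:\Sigma_n\to\Sigma'_n$; composition and identities componentwise. Its extension $\hat f:F(\Sigma)\to F(\Sigma')$ satisfies $\hat f(x)=x$ ($x\in X$), $\hat f(c_n(\psi_0,\dots,\psi_{n-1}))=f_n(c_n)(\hat f(\psi_0),\dots,\hat f(\psi_{n-1}))$. $\mathcal{S}_f$: objects are signatures; a (flexible) morphism $f:\Sigma\to\Sigma'$ is given by a strict morphism $f^\sharp:\Sigma\to T(\Sigma')$; for strict $g:\Sigma\to T(\Sigma')$, $g^\flat$ is the flexible morphism with $(g^\flat)^\sharp=g$. Its extension $\check f:F(\Sigma)\to F(\Sigma')$ satisfies $\check f(x)=x$ ($x\in X$), $\check f(c_n(\psi_0,\dots,\psi_{n-1}))=f^\sharp_n(c_n)[x_0\mid\check f(\psi_0),\dots,x_{n-1}\mid\check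 f(\psi_{n-1})]$, and restricts to $\check f\restriction_n:F(\Sigma)[n]\to F(\Sigma')[n]$. Composition: $(f'\bullet f)^\sharp_n=\check{f'}\restriction_n\circ f^\sharp_n$; identity: $(id_\Sigma)^\sharp=j_\Sigma$. Functors: $(+):\mathcal{S}_s\to\mathcal{S}_f$ is the identity on objects and sends $f:\Sigma\to\Sigma'$ to $(j_{\Sigma'}\circ f)^\flat$; $(-):\mathcal{S}_f\to\mathcal{S}_s$ sends $\Sigma$ to $T(\Sigma)$ and $h$ to $(\check h\restriction_n)_n$. Thus $T(f)=(\hat f\restriction_n)_n:T(\Sigma)\to T(\Sigma')$ for strict $f:\Sigma\to\Sigma'$. $\eta_\Sigma:=j_\Sigma$, and $\varepsilon_\Sigma:T(\Sigma)\to\Sigma$ in $\mathcal{S}_f$ is given by $(\varepsilon_\Sigma)^\sharp_n=id_{F(\Sigma)[n]}$; these are the unit and counit of the adjunction $(+)\dashv(-)$. *)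

(* Defs.v *)
From mathcomp Require Import all_boot.
From mathcomp Require Import boolp classical_sets.

Set Implicit Arguments.
Unset Strict Implicit.
Unset Printing Implicit Defensive.

Local Open Scope classical_set_scope.

Record category := Category {
  ob :> Type;
  hom : ob -> ob -> Type;
  idm : forall a, hom a a;
  comp : forall a b c, hom b c -> hom a b -> hom a c;
  comp_idl : forall a b (f : hom a b), comp (idm b) f = f;
  comp_idr : forall a b (f : hom a b), comp f (idm a) = f;
  comp_assoc : forall a b c d (h : hom c d) (g : hom b c) (f : hom a b),
    comp h (comp g f) = comp (comp h g) f }.

Arguments hom : clear implicits.
Arguments idm : clear implicits.
Arguments comp C {a b c} g f : rename.

Notation "g \o[ C ] f" := (@comp C _ _ _ g f)
  (at level 50, format "g  \o[ C ]  f", left associativity).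

Record is_functor (C D : category) (F0 : C -> D)
    (F1 : forall a b, hom C a b -> hom D (F0 a) (F0 b)) : Prop := IsFunctor {
  is_functor_id : forall a, F1 a a (idm C a) = idm D (F0 a);
  is_functor_comp : forall a b c (g : hom C b c) (f : hom C a b),
    F1 a c (g \o[C] f) = F1 b c g \o[D] F1 a b f }.

Record functor (C D : category) := Functor {
  fob :> C -> D;
  fmap : forall a b, hom C a b -> hom D (fob a) (fob b);
  functorP : is_functor fmap }.

Arguments fmap {C D} F {a b} f : rename.
Arguments Functor {C D fob fmap} functorP.

Lemma fmap_id C D (F : functor C D) a : fmap F (idm C a) = idm D (F a).
Proof. exact: is_functor_id (functorP F) a. Qed.

Lemma fmap_comp C D (F : functor C D) a b c (g : hom C b c) (f : hom C a b) :
  fmap F (g \o[C] f) = fmap F g \o[D] fmap F f.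
Proof. exact: is_functor_comp (functorP F) _ _ _ g f. Qed.

Lemma is_functor_idf C : @is_functor C C (fun a => a) (fun _ _ f => f).
Proof. by []. Qed.

Definition idf C : functor C C := Functor (is_functor_idf C).

Lemma is_functor_compf C D E (G : functor D E) (F : functor C D) :
  @is_functor C E (fun a => G (F a)) (fun _ _ f => fmap G (fmap F f)).
Proof. by split=> *; rewrite ?fmap_id ?fmap_comp. Qed.

Definition compf C D E (G : functor D E) (F : functor C D) : functor C E :=
  Functor (is_functor_compf G F).

Notation "G \of F" := (compf G F) (at level 50, left associativity).

Record adjunction (C D : category) := Adjunction {
  left_adj : functor C D;
  right_adj : functor D C;
  unit_adj : forall a : C, hom C a (right_adj (left_adj a));
  counit_adj : forall b : D, hom D (left_adj (right_adj b)) b;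
  unit_adj_nat : forall a a' (f : hom C a a'),
    unit_adj a' \o[C] f = fmap right_adj (fmap left_adj f) \o[C] unit_adj a;
  counit_adj_nat : forall b b' (g : hom D b b'),
    g \o[D] counit_adj b = counit_adj b' \o[D] fmap left_adj (fmap right_adj g);
  triangle_left : forall a,
    counit_adj (left_adj a) \o[D] fmap left_adj (unit_adj a)
    = idm D (left_adj a);
  triangle_right : forall b,
    fmap right_adj (counit_adj b) \o[C] unit_adj (right_adj b)
    = idm C (right_adj b) }.

Record monad (C : category) := Monad {
  mfun : functor C C;
  munit : forall a, hom C a (mfun a);
  mmul : forall a, hom C (mfun (mfun a)) (mfun a);
  munit_nat : forall a b (f : hom C a b),
    munit b \o[C] f = fmap mfun f \o[C] munit a;
  mmul_nat : forall a b (f : hom C a b),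
    fmap mfun f \o[C] mmul a = mmul b \o[C] fmap mfun (fmap mfun f);
  mmul_unitl : forall a, mmul a \o[C] munit (mfun a) = idm C (mfun a);
  mmul_unitr : forall a, mmul a \o[C] fmap mfun (munit a) = idm C (mfun a);
  mmul_assoc : forall a,
    mmul a \o[C] fmap mfun (mmul a) = mmul a \o[C] mmul (mfun a) }.

Arguments munit {C} M a : rename.
Arguments mmul {C} M a : rename.

Section MonadOfAdjunction.
Variables (C D : category) (A : adjunction C D).
Let L := left_adj A.
Let R := right_adj A.
Let T := R \of L.
Let eta (a : C) : hom C a (T a) := unit_adj A a.
Let mu (a : C) : hom C (T (T a)) (T a) := fmap R (counit_adj A (L a)).

Lemma adj_mmul_nat a b (f : hom C a b) :
  fmap T f \o[C] mu a = mu b \o[C] fmap T (fmap T f).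
Proof. by rewrite /mu /= -!fmap_comp counit_adj_nat. Qed.

Lemma adj_mmul_unitr a : mu a \o[C] fmap T (eta a) = idm C (T a).
Proof. by rewrite /mu /= -fmap_comp triangle_left fmap_id. Qed.

Lemma adj_mmul_assoc a : mu a \o[C] fmap T (mu a) = mu a \o[C] mu (T a).
Proof. by rewrite /mu /= -!fmap_comp -counit_adj_nat. Qed.

Definition monad_of_adjunction : monad C :=
  @Monad C T eta mu (fun a b f => unit_adj_nat A f)
    adj_mmul_nat (fun a => triangle_right A (L a))
    adj_mmul_unitr adj_mmul_assoc.

End MonadOfAdjunction.

Section Kleisli.
Variables (C : category) (M : monad C).
Let T := mfun M.

Definition kleisli_hom (a b : C) := hom C a (T b).

Definition kleisli_comp (a b c : C)
    (g : kleisli_hom b c) (f : kleisli_hom a b) : kleisli_hom a c :=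
  mmul M c \o[C] fmap T g \o[C] f.

Lemma kleisli_idl a b (f : kleisli_hom a b) : kleisli_comp (munit M b) f = f.
Proof. by rewrite /kleisli_comp mmul_unitr comp_idl. Qed.

Lemma kleisli_idr a b (f : kleisli_hom a b) : kleisli_comp f (munit M a) = f.
Proof.
by rewrite /kleisli_comp -comp_assoc -munit_nat comp_assoc mmul_unitl comp_idl.
Qed.

Lemma kleisli_assoc a b c d
    (h : kleisli_hom c d) (g : kleisli_hom b c) (f : kleisli_hom a b) :
  kleisli_comp h (kleisli_comp g f) = kleisli_comp (kleisli_comp h g) f.
Proof.
rewrite /kleisli_comp !fmap_comp !comp_assoc mmul_assoc.
by rewrite -[in RHS](comp_assoc (mmul M d)) -mmul_nat !comp_assoc.
Qed.

Definition kleisli : category :=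
  Category kleisli_idl kleisli_idr kleisli_assoc.

Lemma kleisli_left_is_functor :
  @is_functor C kleisli (fun a => a) (fun a b f => munit M b \o[C] f).
Proof.
split=> [a|a b c g f] /=; first by rewrite comp_idr.
rewrite /kleisli_comp fmap_comp !comp_assoc mmul_unitr comp_idl.
by rewrite -munit_nat.
Qed.

Lemma kleisli_right_is_functor :
  @is_functor kleisli C (fun a => T a) (fun a b g => mmul M b \o[C] fmap T g).
Proof.
split=> [a|a b c g f] /=; first by rewrite mmul_unitr.
rewrite /kleisli_comp !fmap_comp !comp_assoc mmul_assoc.
by rewrite -[in LHS](comp_assoc (mmul M c)) -mmul_nat !comp_assoc.
Qed.

Definition kleisli_left : functor C kleisli := Functor kleisli_left_is_functor.
Definition kleisli_right : functor kleisli C :=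
  Functor kleisli_right_is_functor.

Lemma kleisli_unit_nat a a' (f : hom C a a') :
  munit M a' \o[C] f = fmap kleisli_right (fmap kleisli_left f) \o[C] munit M a.
Proof. by rewrite /= fmap_comp comp_assoc mmul_unitr comp_idl munit_nat. Qed.

Definition kleisli_counit (b : kleisli) :
  hom kleisli (kleisli_left (kleisli_right b)) b := idm C (T b).

Lemma kleisli_counit_nat b b' (g : hom kleisli b b') :
  g \o[kleisli] kleisli_counit b
  = kleisli_counit b' \o[kleisli] fmap kleisli_left (fmap kleisli_right g).
Proof.
rewrite /= /kleisli_comp /kleisli_counit fmap_id !comp_idr !comp_assoc.
by rewrite mmul_unitl comp_idl.
Qed.

Lemma kleisli_triangle_left a :
  kleisli_counit (kleisli_left a) \o[kleisli] fmap kleisli_left (munit M a)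
  = idm kleisli (kleisli_left a).
Proof.
rewrite /= /kleisli_comp /kleisli_counit fmap_id comp_idr comp_assoc.
by rewrite mmul_unitl comp_idl.
Qed.

Lemma kleisli_triangle_right b :
  fmap kleisli_right (kleisli_counit b) \o[C] munit M (kleisli_right b)
  = idm C (kleisli_right b).
Proof. by rewrite /= /kleisli_counit fmap_id comp_idr mmul_unitl. Qed.

Definition kleisli_adjunction : adjunction C kleisli :=
  @Adjunction C kleisli kleisli_left kleisli_right (munit M) kleisli_counit
    kleisli_unit_nat kleisli_counit_nat
    kleisli_triangle_left kleisli_triangle_right.

End Kleisli.

(* Disjointness of the [S n] is built in: a connective is given with its
   arity, so connectives of different arities are never identified. *)
Definition signature := nat -> Type.

(* [Var k] is the variable x_k. *)
Inductive formula (S : signature) : Type :=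
| Var of nat
| App n of S n & ('I_n -> formula S).

Arguments Var {S} k.
Arguments App {S n} c psi.

Fixpoint vars S (phi : formula S) : set nat :=
  match phi with
  | Var k => [set k]
  | App n c psi => \bigcup_i vars (psi i)
  end.

Definition formula_in S n := {phi : formula S | vars phi = `I_n}.

Definition tsig (S : signature) : signature := fun n => formula_in S n.

(* phi[x_0 | psi_0, ..., x_{n-1} | psi_{n-1}]; the variables x_k with n <= k
   are left unchanged. *)
Fixpoint subst S n (psi : 'I_n -> formula S) (phi : formula S) : formula S :=
  match phi with
  | Var k => oapp psi (Var k) (insub k)
  | App m c theta => App c (fun i => subst psi (theta i))
  end.

Lemma vars_subst S n (psi : 'I_n -> formula S) (phi : formula S) :
  vars phi `<=` `I_n ->
  vars (subst psi phi)
  = [set k | exists2 i : 'I_n, vars phi i & vars (psi i) k].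
Proof.
elim: phi => [k|m c theta IH] /= sub; apply/seteqP; split=> l /=.
- have kn : (k < n)%N by apply: sub.
  by rewrite insubT /= => ?; exists (Ordinal kn).
- case=> i ik li; have kn : (k < n)%N by apply: sub.
  rewrite insubT /=; suff -> : Sub k kn = i by [].
  exact: val_inj.
- case=> i _; rewrite IH => [[j vj lj]|k vk]; last by apply: sub; exists i.
  by exists j => //; exists i.
- case=> j [i _ vj] lj; exists i => //; rewrite IH; first by exists j.
  by move=> k vk; apply: sub; exists i.
Qed.

Lemma subst_subst S m n (psi : 'I_n -> formula S) (theta : 'I_m -> formula S)
    (phi : formula S) :
  vars phi `<=` `I_m ->
  subst psi (subst theta phi) = subst (fun i => subst psi (theta i)) phi.
Proof.
elim: phi => [k|l c chi IH] /= sub; first by rewrite insubT //; apply: sub.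
congr App; apply: funext => i; apply: IH => k vk; apply: sub; by exists i.
Qed.

Lemma subst_var S n (phi : formula S) :
  subst (fun i : 'I_n => Var i) phi = phi.
Proof.
elim: phi => [k|l c chi IH] /=; first by case: insubP => //= i _ ->.
by congr App; apply: funext.
Qed.

Lemma eq_formula_in S n (u v : formula_in S n) : sval u = sval v -> u = v.
Proof.
case: u v => [phi Hphi] [psi Hpsi] /= eq_phi; case: _ / eq_phi Hpsi => Hpsi.
by congr exist; exact: Prop_irrelevance.
Qed.

Lemma jmap_subproof (S : signature) n (c : S n) :
  vars (App c (fun i => Var i)) = `I_n.
Proof.
apply/seteqP; split=> k /=; first by case=> i _ ->.
by move=> kn; exists (Ordinal kn).
Qed.

Definition jmap (S : signature) n (c : S n) : tsig S n :=
  exist _ (App c (fun i => Var i)) (jmap_subproof c).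

Definition strict (S S' : signature) := forall n, S n -> S' n.

Definition strict_id (S : signature) : strict S S := fun n c => c.
Definition strict_comp (S S' S'' : signature)
    (g : strict S' S'') (f : strict S S') : strict S S'' :=
  fun n c => g n (f n c).

Lemma eq_strict S S' (f g : strict S S') : (forall n c, f n c = g n c) -> f = g.
Proof. by move=> fg; apply: functional_extensionality_dep => n; exact: funext. Qed.

Definition Ss : category :=
  @Category signature strict strict_id strict_comp
    (fun _ _ _ => erefl) (fun _ _ _ => erefl) (fun _ _ _ _ _ _ _ => erefl).

Fixpoint hat S S' (f : strict S S') (phi : formula S) : formula S' :=
  match phi with
  | Var k => Var k
  | App n c psi => App (f n c) (fun i => hat f (psi i))
  end.

Lemma vars_hat S S' (f : strict S S') phi : vars (hat f phi) = vars phi.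
Proof. by elim: phi => //= n c psi IH; apply: eq_bigcupr. Qed.

Definition tmap S S' (f : strict S S') : strict (tsig S) (tsig S') :=
  fun n phi => exist _ (hat f (sval phi)) (etrans (vars_hat f _) (svalP phi)).

(* [sharp] and [Flat] are the operations f |-> f^sharp and g |-> g^flat. *)
Record flexible (S S' : signature) := Flat { sharp : strict S (tsig S') }.

Lemma eq_flexible S S' (f g : flexible S S') : sharp f = sharp g -> f = g.
Proof. by case: f g => [f] [g] /= ->. Qed.

Fixpoint check S S' (f : flexible S S') (phi : formula S) : formula S' :=
  match phi with
  | Var k => Var k
  | App n c psi => subst (fun i => check f (psi i)) (sval (sharp f c))
  end.

Lemma vars_check S S' (f : flexible S S') phi : vars (check f phi) = vars phi.
Proof.
elim: phi => //= n c psi IH.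
have E := svalP (sharp f c); rewrite vars_subst ?E //.
apply/seteqP; split=> k /=; first by case=> i _; rewrite IH; exists i.
by case=> i _ ki; exists i; rewrite ?IH //=.
Qed.

(* The restrictions of [check f] to the sets F(S)[n]; a strict morphism. *)
Definition checkn S S' (f : flexible S S') : strict (tsig S) (tsig S') :=
  fun n phi =>
    exist _ (check f (sval phi)) (etrans (vars_check f _) (svalP phi)).

Definition flex_id (S : signature) : flexible S S := Flat (@jmap S).
Definition flex_comp (S S' S'' : signature)
    (g : flexible S' S'') (f : flexible S S') : flexible S S'' :=
  Flat (strict_comp (checkn g) (sharp f)).

Lemma check_id S phi : check (flex_id S) phi = phi.
Proof.
elim: phi => //= n c psi IH; congr App; apply: funext => i.
by rewrite insubT //= => lt; rewrite IH; congr psi; apply: val_inj.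
Qed.

Lemma check_subst S S' (f : flexible S S') n (psi : 'I_n -> formula S) phi :
  check f (subst psi phi) = subst (fun i => check f (psi i)) (check f phi).
Proof.
elim: phi => [k|m c theta IH] /=; first by case: insubP.
have E := svalP (sharp f c); rewrite subst_subst ?E //.
by congr subst; apply: funext.
Qed.

Lemma check_comp S S' S'' (g : flexible S' S'') (f : flexible S S') phi :
  check (flex_comp g f) phi = check g (check f phi).
Proof.
elim: phi => //= n c psi IH; rewrite check_subst.
by congr subst; apply: funext.
Qed.

Lemma flex_idl S S' (f : flexible S S') : flex_comp (flex_id S') f = f.
Proof.
apply/eq_flexible/eq_strict => n c; apply: eq_formula_in; exact: check_id.
Qed.

Lemma flex_idr S S' (f : flexible S S') : flex_comp f (flex_id S) = f.
Proof.
apply/eq_flexible/eq_strict => n c; apply: eq_formula_in; exact: subst_var.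
Qed.

Lemma flex_assoc S S' S'' S''' (h : flexible S'' S''') (g : flexible S' S'')
    (f : flexible S S') :
  flex_comp h (flex_comp g f) = flex_comp (flex_comp h g) f.
Proof.
apply/eq_flexible/eq_strict => n c; apply: eq_formula_in => /=.
by rewrite check_comp.
Qed.

Definition Sf : category :=
  @Category signature flexible flex_id flex_comp flex_idl flex_idr flex_assoc.

Definition plus_map S S' (f : strict S S') : flexible S S' :=
  Flat (strict_comp (@jmap S') f).

Lemma check_plus S S' (f : strict S S') phi : check (plus_map f) phi = hat f phi.
Proof.
elim: phi => //= n c psi IH; congr App; apply: funext => i.
by rewrite insubT //= => lt; rewrite IH; congr (hat f (psi _)); apply: val_inj.
Qed.

Lemma checkn_plus S S' (f : strict S S') : checkn (plus_map f) = tmap f.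
Proof.
by apply: eq_strict => n phi; apply: eq_formula_in; exact: check_plus.
Qed.

Lemma plus_is_functor : @is_functor Ss Sf (fun S => S) plus_map.
Proof.
split=> [//|S S' S'' g f].
apply/eq_flexible/eq_strict => n c; apply: eq_formula_in => /=.
congr App; apply: funext => i.
by rewrite insubT //= => lt; congr Var.
Qed.

Definition plus : functor Ss Sf := Functor plus_is_functor.

Lemma minus_is_functor : @is_functor Sf Ss tsig checkn.
Proof.
split=> [S|S S' S'' g f]; apply: eq_strict => n c; apply: eq_formula_in.
  exact: check_id.
exact: check_comp.
Qed.

Definition minus : functor Sf Ss := Functor minus_is_functor.

Definition sig_unit (S : Ss) : hom Ss S (minus (plus S)) := @jmap S.
Definition sig_counit (S : Sf) : hom Sf (plus (minus S)) S :=
  @Flat (tsig S) S (fun n phi => phi).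

Arguments sig_unit : clear implicits.
Arguments sig_counit : clear implicits.

Lemma sig_unit_nat S S' (f : hom Ss S S') :
  sig_unit S' \o[Ss] f = fmap minus (fmap plus f) \o[Ss] sig_unit S.
Proof.
apply: eq_strict => n c; apply: eq_formula_in => /=.
congr App; apply: funext => i.
by rewrite insubT //= => lt; congr Var.
Qed.

Lemma sig_counit_nat S S' (g : hom Sf S S') :
  g \o[Sf] sig_counit S = sig_counit S' \o[Sf] fmap plus (fmap minus g).
Proof.
apply/eq_flexible/eq_strict => n phi; apply: eq_formula_in => /=.
by rewrite subst_var.
Qed.

Lemma sig_triangle_left S :
  sig_counit (plus S) \o[Sf] fmap plus (sig_unit S) = idm Sf (plus S).
Proof.
apply/eq_flexible/eq_strict => n c; apply: eq_formula_in.
exact: subst_var.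
Qed.

Lemma sig_triangle_right S :
  fmap minus (sig_counit S) \o[Ss] sig_unit (minus S) = idm Ss (minus S).
Proof.
by apply: eq_strict => n phi; apply: eq_formula_in; exact: subst_var.
Qed.

Definition sig_adjunction : adjunction Ss Sf :=
  @Adjunction Ss Sf plus minus sig_unit sig_counit sig_unit_nat sig_counit_nat sig_triangle_left sig_triangle_right.

Definition sig_monad : monad Ss := monad_of_adjunction sig_adjunction.

Lemma sig_monad_fmap S S' (f : strict S S') : fmap (mfun sig_monad) f = tmap f.
Proof. exact: checkn_plus. Qed.

(* Main.v *)
(** Everything reduces to the identity [f = eps • (+) f^sharp] in [Sf]: applying
    the functor [(-)] to it yields [(-) f = mu o T f^sharp], which says both
    that composition in [Sf] is Kleisli composition and that [(-)] is the
    canonical right adjoint. *)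
From mathcomp Require Import all_boot boolp.
Require Import Defs.

(** Sharing [F0] avoids transport along an equality of object maps; the functor laws are
    propositions, hence proof-irrelevant. *)
Lemma eq_functor (C D : category) (F0 : C -> D)
    (F1 G1 : forall a b, hom C a b -> hom D (F0 a) (F0 b))
    (HF : is_functor F1) (HG : is_functor G1) :
  (forall a b (f : hom C a b), F1 a b f = G1 a b f) ->
  Functor HF = Functor HG.
Proof.
move=> FG; have {}FG : F1 = G1.
  by do 2 (apply: functional_extensionality_dep => ?); apply: funext => f.
by case: _ / FG HG => HG; rewrite (Prop_irrelevance HF HG).
Qed.

(** The right side substitutes each x_i for itself in the formula [sharp f c]. *)
Lemma flexible_counit (S S' : signature) (f : flexible S S') :
  f = sig_counit S' \o[Sf] fmap plus (sharp f).
Proof.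
apply: eq_flexible; apply: eq_strict => n c; apply: eq_formula_in.
exact/esym/subst_var.
Qed.

Lemma checkn_mmul (S S' : signature) (f : flexible S S') :
  checkn f = mmul sig_monad S' \o[Ss] fmap (mfun sig_monad) (sharp f).
Proof. by rewrite {1}(flexible_counit _ _ f); exact: fmap_comp minus _ _ _ _ _. Qed.


Theorem theorem1p12 :
  (* [sharp], with inverse [Flat], is an identity-on-objects isomorphism of
     categories between [Sf] and the Kleisli category; it carries [plus] and
     [minus] to the canonical functors of the Kleisli adjunction. *)
  (exists (HK : @is_functor Sf (kleisli sig_monad)
                  (fun S => S) (fun S S' f => sharp f))
          (HK' : @is_functor (kleisli sig_monad) Sf
                  (fun S => S) (fun S S' g => Flat g)),
     let K : functor Sf (kleisli sig_monad) := Functor HK in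
     let K' : functor (kleisli sig_monad) Sf := Functor HK' in
     (K' \of K = idf Sf) /\
     (K \of K' = idf (kleisli sig_monad)) /\
     (K \of plus = left_adj (kleisli_adjunction sig_monad)) /\
     (minus = right_adj (kleisli_adjunction sig_monad) \of K)) /\
  (forall (S S' S'' : signature) (f : flexible S S') (f' : flexible S' S''),
     (f' \o[Sf] f
      = Flat (mmul sig_monad S''
              \o[Ss] fmap (mfun sig_monad) (sharp f') \o[Ss] sharp f)) /\
     (checkn f' \o[Ss] sharp f
      = mmul sig_monad S''
        \o[Ss] (fmap (mfun sig_monad) (sharp f') \o[Ss] sharp f))).
Proof.
have sharp_comp (S S' S'' : signature) (g : flexible S' S'')
    (f : flexible S S') : sharp (flex_comp g f)
    = mmul sig_monad S'' \o[Ss] fmap (mfun sig_monad) (sharp g) \o[Ss] sharp f.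
  exact: (congr1 (fun h => strict_comp h (sharp f)) (checkn_mmul _ _ g)).
split; last first.
  move=> S S' S'' f f'; split; first exact/eq_flexible/sharp_comp.
  by rewrite comp_assoc; exact: sharp_comp.
have HK : @is_functor Sf (kleisli sig_monad)
    (fun S => S) (fun S S' f => sharp f) by split=> // *; exact: sharp_comp.
have HK' : @is_functor (kleisli sig_monad) Sf
    (fun S => S) (fun S S' g => Flat g).
  split=> // S S' S'' g f; apply: eq_flexible; apply: esym.
  exact: (sharp_comp _ _ _ (Flat g) (Flat f)).
(* The object maps agree by conversion. So do the morphism maps for [K \of K'] and [K \of plus],
   which leaves [K' \of K] and [minus]. *)
exists HK, HK'; do !split; apply: eq_functor => S S' f //=.
- exact: eq_flexible.
- exact: checkn_mmul.
Qed.
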